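(* Every $k$-decomposable multicomplex $\Gamma\subset\mathbb N_\infty^n$ is shellable. Also, every shellable multicomplex is $k$-decomposable for some $k\geq 0$.
   Context: Let $\mathbb N$ be the set of non-negative integers and $\mathbb N_\infty=\mathbb N\cup\{\infty\}$. Order $\mathbb N_\infty^n$ by $a\preceq b$ iff $a(i)\le b(i)$ for all $i$. For $a\in\mathbb N_\infty^n$ put $\mathrm{fpt}(a)=\{i:a(i)\neq\infty\}$, $\mathrm{infpt}(a)=\{i:a(i)=\infty\}$, $\mathrm{fpt}^\ast(a)=\{i:0<a(i)<\infty\}$. For $\Gamma\subset\mathbb N_\infty^n$ let $\mathcal M(\Gamma)$ be the set of maximal elements of $\Gamma$ with respect to $\preceq$. $\Gamma$ is a multicomplex if (1) $a\in\Gamma$ and $b\preceq a$ imply $b\in\Gamma$; (2) for every $a\in\Gamma$ there is $m\in\mathcal M(\Gamma)$ with $a\preceq m$. Elements of $\Gamma$ are called faces. A face $a\in\Gamma$ is a facet if $\mathrm{infpt}(a)=\mathrm{infpt}(m)$ for all $m\in\mathcal M(\Gamma)$ with $a\preceq m$; $\mathcal F(\Gamma)$ is the set of facets. For $A\subset\mathbb N_\infty^n$, $\langle A\rangle$ denotes the smallest multicomplex containing $A$. Put $\dim(a)=|\mathrm{infpt}(a)|-1$ and $\dim(\Gamma)=\max\{\dim(a):a\in\Gamma\}$. A Stanley set of degree $a$ (with $a\in\mathbb N^n$) is a set $S=a+S^\ast$ with $S^\ast=\langle m\rangle$ for some $m\in\{0,\infty\}^n$. Shellable: $\Gamma$ is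 shellable if its facets can be ordered $a_1,\ldots,a_r$ such that (1) $S_i=\langle a_i\rangle\setminus\langle a_1,\ldots,a_{i-1}\rangle$ is a Stanley set for $i=1,\ldots,r$; (2) if $S_i^\ast\subset S_j^\ast$ then $S_i^\ast=S_j^\ast$ or $i>j$. For $a\in\Gamma$ define $\mathrm{star}_\Gamma a=\langle b\in\mathcal F(\Gamma): a\preceq b\rangle$, $\Gamma\setminus a=\langle b\in\mathcal F(\Gamma): a\not\preceq b\rangle$, $\mathrm{link}_\Gamma a=\langle b-a: b\in\mathcal F(\Gamma),\ a\preceq b\rangle$ (coordinatewise subtraction, $\infty-c=\infty$ for $c\in\mathbb N$). Shedding face: let $\Gamma$ be a $(d-1)$-dimensional multicomplex and $0\le k\le d-1$. An element $a\in\Gamma\cap\mathbb N^n$ with $|\mathrm{fpt}^\ast(a)|\le k+1$ is a shedding face if (i) for all $b\in\mathcal F(\mathrm{star}_\Gamma a)$, $\langle b\rangle\setminus(\Gamma\setminus a)$ is a Stanley set of degree $a$; (ii) for every $b\in\mathcal F(\mathrm{star}_\Gamma a)$ and every $c\in\mathcal F(\Gamma\setminus a)$, if $\mathrm{fpt}(b)\subseteq\mathrm{fpt}(c)$ then $\mathrm{fpt}(b)=\mathrm{fpt}(c)$. $k$-decomposable: let $\Gamma$ be a $(d-1)$-dimensional multicomplex and $0\le k\le d-1$. $\Gamma$ is (recursively) $k$-decomposable if it has only one facet or there exists a shedding face $a\in\Gamma$ with $|\mathrm{fpt}^\ast(a)|\le k+1$ such that both $\mathrm{link}_\Gamma a$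 and $\Gamma\setminus a$ are $k$-decomposable.
   Formalization: Condition (i) of a shedding face a is required only for facets b of star a with a ⪯ b, the bound k ≤ d−1 is dropped, and Γ is nonempty in the second claim; read literally, the second claim fails for ⟨3⟩ and for ⟨(∞,1,1)⟩. *)

(* Defs.v *)
From mathcomp Require Import all_boot.
From mathcomp Require Import boolp classical_sets.

Set Implicit Arguments.
Unset Strict Implicit.
Unset Printing Implicit Defensive.

Local Open Scope classical_set_scope.

(* [Some p] is the natural number p and [None] is infinity. *)
Definition natinf := option nat.

Definition leinf (x y : natinf) : bool :=
  match x, y with
  | _, None => true
  | None, Some _ => false
  | Some p, Some q => (p <= q)%N
  end.

(* p + x and x - p for a natural number p; infinity absorbs both.  The
   subtraction is truncated, but it is only applied when p <= x. *)
Definition addinf (p : nat) (x : natinf) : natinf := omap (addn p) x.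
Definition subinf (x : natinf) (p : nat) : natinf := omap (fun q => (q - p)%N) x.

Definition vec (n : nat) := {ffun 'I_n -> natinf}.
Definition nvec (n : nat) := {ffun 'I_n -> nat}.

Section Multicomplex.
Variable n : nat.
Implicit Types (a b c m : vec n) (G A S T : set (vec n)) (d : nvec n).

Definition fin_vec d : vec n := [ffun i => Some (d i)].
Definition add_vec d b : vec n := [ffun i => addinf (d i) (b i)].
Definition sub_vec b d : vec n := [ffun i => subinf (b i) (d i)].

Definition prec a b : Prop := forall i, leinf (a i) (b i).

Definition infpt a : {set 'I_n} := [set i | a i == None]%SET.
Definition fpt a : {set 'I_n} := [set i | a i != None]%SET.
Definition fptstar a : {set 'I_n} :=
  [set i | (a i != None) && (a i != Some 0%N)]%SET.

Definition maximal_elements G : set (vec n) :=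
  [set m | G m /\ forall b, G b -> prec m b -> b = m].

Definition multicomplex G : Prop :=
  (forall a b, G a -> prec b a -> G b) /\
  (forall a, G a -> exists2 m, maximal_elements G m & prec a m).

Definition facets G : set (vec n) :=
  [set a | G a /\
    forall m, maximal_elements G m -> prec a m -> infpt a = infpt m].

Definition generated A : set (vec n) := smallest multicomplex A.

Definition zero_infinite m : Prop := forall i, m i = Some 0%N \/ m i = None.

(* S is a Stanley set of degree d with S^* = T.  As d = min S and
   d + m = max S, both d and T are determined by S. *)
Definition stanley_with d T S : Prop :=
  exists m, [/\ zero_infinite m, T = generated [set m] & S = add_vec d @` T].

Definition stanley_set_of_degree d S : Prop := exists T, stanley_with d T S.

Definition stanley_star S T : Prop := exists d, stanley_with d T S.

Definition stanley_set S : Prop := exists d, stanley_set_of_degree d S.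

Definition shelling_step (r : nat) (a : 'I_r -> vec n) (i : 'I_r) :
    set (vec n) :=
  generated [set a i] `\` generated [set a j | j in [set j : 'I_r | (j < i)%N]].

Definition shellable G : Prop :=
  exists (r : nat) (a : 'I_r -> vec n),
    [/\ injective a,
        facets G = range a,
        forall i, stanley_set (shelling_step a i) &
        forall (i j : 'I_r) Si Sj,
          stanley_star (shelling_step a i) Si ->
          stanley_star (shelling_step a j) Sj ->
          Si `<=` Sj -> Si = Sj \/ (j < i)%N].

Definition star G d : set (vec n) :=
  generated [set b | facets G b /\ prec (fin_vec d) b].

Definition deletion G d : set (vec n) :=
  generated [set b | facets G b /\ ~ prec (fin_vec d) b].

Definition link G d : set (vec n) :=
  generated [set sub_vec b d | b in [set b | facets G b /\ prec (fin_vec d) b]].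

(* In (i), b ranges over the facets of the star lying above d, which are
   exactly the facets of G above d.  A facet b of the star not above d (say
   0 in <3> for d = 3) satisfies <b> `<=` deletion G d, so for it the
   difference would be empty and no d > 0 could shed a face of <3>. *)
Definition shedding_face (k : nat) G d : Prop :=
  [/\ G (fin_vec d),
      (#|fptstar (fin_vec d)| <= k.+1)%N,
      forall b, facets (star G d) b -> prec (fin_vec d) b ->
        stanley_set_of_degree d (generated [set b] `\` deletion G d) &
      forall b c, facets (star G d) b -> facets (deletion G d) c ->
        fpt b \subset fpt c -> fpt b = fpt c].

(* k is an arbitrary natural number, not bounded by the dimension of G: links
   and deletions can have smaller dimension than G, and <(oo,1,1)>, which is
   shellable of dimension 0, has no shedding face for k = 0, as (i) at
   b = (oo,1,1) forces d = (j,1,1). *)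
Inductive k_decomposable (k : nat) : set (vec n) -> Prop :=
| Decomposable_one_facet G b :
    facets G = [set b] -> k_decomposable k G
| Decomposable_shedding G d :
    shedding_face k G d ->
    k_decomposable k (link G d) ->
    k_decomposable k (deletion G d) ->
    k_decomposable k G.

End Multicomplex.

(* Main.v *)
(* Deleting a shedding face [d] splits the facets of [G] into those of the
   deletion and the translates by [d] of those of the link; condition (ii)
   ensures that the deletion has no facet that is not one of [G].  Hence a
   shelling of the deletion followed by the translate of a shelling of the link
   is a shelling of [G].  Conversely, the degree of the last Stanley set of a
   shelling is a shedding face: only the last facet lies above it, so its link
   has one facet and its deletion is shelled by the remaining facets.  The
   size condition holds trivially for [k = n].  Dickson's lemma makes the set
   of facets finite, so that generated multicomplexes are down-closures. *)
Require Import Defs.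
From mathcomp Require Import all_boot.
From mathcomp Require Import boolp classical_sets cardinality zify.

Set Implicit Arguments.
Unset Strict Implicit.
Unset Printing Implicit Defensive.

Local Open Scope classical_set_scope.

(** * The order on N_oo *)

Lemma leinf_refl : reflexive leinf.
Proof. by case=> /=. Qed.

Lemma leinf_trans : transitive leinf.
Proof. by move=> [y|] [x|] [z|] //=; apply: leq_trans. Qed.

Lemma leinf_anti : antisymmetric leinf.
Proof.
by move=> [x|] [y|] //=; rewrite -eqn_leq => /eqP ->.
Qed.

(** Every tail of [g] attains a least value; repeatedly picking a minimizer of the tail beyond the
    previous pick gives the subsequence. *)
Lemma leinf_nondecreasing_subseq (g : nat -> natinf) :
  exists2 h : nat -> nat, {homo h : i j / i < j} &
    {homo g \o h : i j / i <= j >-> leinf i j}.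
Proof.
have /choice[m mP] N :
    exists k, N <= k /\ forall j, N <= j -> leinf (g k) (g j).
  have [[p ex_p]|noN] := pselect (exists p, exists2 j, N <= j & g j = Some p).
    have exp : exists p, `[< exists2 j, N <= j & g j = Some p >].
      by exists p; apply/asboolP.
    case: (ex_minnP exp) => q /asboolP[k leNk gk] minq.
    exists k; split=> // j leNj; rewrite gk; case gj: (g j) => [y|] //=.
    by apply: minq; apply/asboolP; exists j.
  (* No finite value occurs from [N] on, so the tail is constantly infinite. *)
  exists N; split=> // j leNj; case gj: (g j) => [y|] /=; last by case: (g N).
  by case: noN; exists y, j.
pose h := fix h i := if i is i'.+1 then m (h i').+1 else m 0.
have ltS i : h i < h i.+1 by case: (mP (h i).+1).
exists h; first exact: (homo_ltn ltn_trans).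
apply: (homo_leq leinf_refl) => [y x z|i /=]; first exact: leinf_trans.
(* Each [h i] minimizes [g] over a tail that contains [h i.+1]. *)
have [N ->] : exists N, h i = m N by case: i => [|i]; eexists.
by apply: (mP N).2; apply: leq_trans (mP _).1; apply: leqW; apply: (mP N).1.
Qed.

Section Multicomplex.
Variable n : nat.
Implicit Types (a b c m x y : vec n) (d e : nvec n) (G A P : set (vec n)).

(** * Dickson's lemma for N_oo^n *)

Lemma prec_refl a : prec a a.
Proof. by move=> i; apply: leinf_refl. Qed.

Lemma prec_trans b a c : prec a b -> prec b c -> prec a c.
Proof. by move=> ab bc i; apply: leinf_trans (ab i) (bc i). Qed.

Lemma prec_anti a b : prec a b -> prec b a -> a = b.
Proof. by move=> ab ba; apply/ffunP => i; apply/leinf_anti/andP. Qed.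

Lemma infptS a b : prec a b -> infpt a \subset infpt b.
Proof.
move=> ab; apply/fintype.subsetP => i; rewrite !inE => /eqP ai.
by move: (ab i); rewrite ai; case: (b i).
Qed.

Lemma fpt_infpt a : fpt a = (~: infpt a)%SET.
Proof. by apply/setP => i; rewrite !inE. Qed.

Lemma fptS a b : (fpt a \subset fpt b) = (infpt b \subset infpt a).
Proof. by rewrite !fpt_infpt finset.setCS. Qed.

Lemma infpt_eq a b : fpt a = fpt b <-> infpt a = infpt b.
Proof. by rewrite !fpt_infpt; split=> [/finset.setC_inj|->]. Qed.

(* Dickson's lemma: N_oo^n is a well-quasi-order. *)
Lemma prec_nondecreasing_subseq (f : nat -> vec n) :
  exists2 h : nat -> nat, {homo h : i j / i < j} &
    forall i j, i <= j -> prec (f (h i)) (f (h j)).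
Proof.
suff [h hlt hP] : exists2 h : nat -> nat, {homo h : i j / i < j} &
    forall l, l \in enum 'I_n -> {homo (fun i => f (h i) l) : i j / i <= j >-> leinf i j}.
  by exists h => // i j leij l; apply: hP; rewrite ?mem_enum.
elim: (enum 'I_n) => [|l s [h hlt hP]]; first by exists id.
have [g glt gP] := leinf_nondecreasing_subseq (fun i => f (h i) l).
exists (h \o g) => [i j ltij|k]; first exact/hlt/glt.
rewrite inE => /predU1P[->|/hP kP] i j leij; first exact: gP.
by apply: kP; case: ltngtP leij => // [/glt/ltnW|->].
Qed.

Lemma infinite_set_injection T (A : set T) :
  infinite_set A -> exists2 f : nat -> T, injective f & forall i, A (f i).
Proof.
elim/Ppointed: T => T in A *; first by rewrite emptyE => /(_ (finite_set0 _)).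
move=> /infiniteP/pcard_leP/injfunPex[f fA finj]; exists f => [i j|i].
  by apply: finj; rewrite in_setT.
exact: fA.
Qed.

(** An infinite antichain would contain an injective sequence, and Dickson's lemma makes two of its
    terms comparable. *)
Lemma antichain_finite A :
  (forall a b, A a -> A b -> prec a b -> a = b) -> finite_set A.
Proof.
move=> antiA; apply: contrapT => /infinite_set_injection[f finj fA].
have [h hlt hP] := prec_nondecreasing_subseq f.
by have /finj := antiA _ _ (fA _) (fA _) (hP 0 1 isT); apply/eqP; rewrite ltn_eqF ?hlt.
Qed.

(** * Down-closures of finite sets *)

(* Downward closure; for finite [A], this is [generated A]. *)
Definition down A : set (vec n) := [set x | exists2 a, A a & prec x a].

Lemma downS A x y : prec x y -> down A y -> down A x.
Proof. by move=> xy [a Aa ya]; exists a => //; apply: prec_trans ya. Qed.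

Lemma sub_down A : A `<=` down A.
Proof. by move=> a Aa; exists a => //; apply: prec_refl. Qed.

Lemma maximal_down A m : maximal_elements (down A) m -> A m.
Proof. by move=> [[a Aa ma] /(_ a (sub_down Aa) ma) <-]. Qed.

(** Finiteness provides the maximal elements, by climbing inside [A]; the finite numbers in N_oo
    form a down-set with none. *)
Lemma down_finite_multicomplex A : finite_set A -> multicomplex (down A).
Proof.

move=> /finite_seqP[s defA]; split=> [x y xA yx|x [a Aa xa]]; first exact: downS xA.
suff [m mA am] : exists2 m, maximal_elements (down A) m & prec a m.
  by exists m => //; apply: prec_trans am.
(* The climb terminates: passing from [a] to a strictly larger [b] loses at least [a] itself from
   the entries of [s] above. *)
pose N b := count (fun c => `[< prec b c >]) s.
have [k] := ubnP (N a); elim: k => // k IHk in a Aa {xa} *; rewrite ltnS => leNk.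
have [amax|] := pselect (maximal_elements (down A) a).
  by exists a => //; apply: prec_refl.
move=> /not_andP[/(_ (sub_down Aa))//|/existsNP[c /not_implyP[[b Ab cb]]]].
move=> /not_implyP[ac neq_ca]; have ab := prec_trans ac cb.
have [|m mA bm] := IHk b Ab; last by exists m => //; apply: prec_trans bm.
apply: leq_trans leNk; move: Aa; rewrite defA /= -has_pred1 has_count => a_s.
apply: (@leq_trans (N b + count_mem a s)); first by rewrite -addn1 leq_add2l.
rewrite -count_predUI (@eq_count _ (predI _ _) pred0) ?count_pred0 ?addn0.
  apply: sub_count => z /orP[/asboolP bz|/eqP ->]; apply/asboolP.
    exact: prec_trans ab bz.
  exact: prec_refl.
move=> z /=; apply/negbTE/negP => /andP[/asboolP bz /eqP za].
by apply: neq_ca; apply: prec_anti => //; apply: prec_trans cb _; rewrite -za.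
Qed.

Lemma generated_finite A : finite_set A -> generated A = down A.
Proof.
move=> finA; apply/seteqP; split=> [|x [a Aa xa] M [[downM _] /(_ a Aa) Ma]].
  exact: (smallest_sub (down_finite_multicomplex finA) (sub_down (A := A))).
exact: downM xa.
Qed.

(** * Facets and their finiteness *)

Lemma maximal_facet G m : maximal_elements G m -> facets G m.
Proof.
by move=> [Gm maxm]; split=> // b [Gb _] mb; rewrite (maxm b).
Qed.

(** The finite coordinates of such an [a] are bounded by those of [m], hence by their maximum [N],
    so [a] is coded by a function between finite types. *)
Lemma finite_same_infpt m : finite_set [set a | prec a m /\ infpt a = infpt m].
Proof.
pose N := \max_i odflt 0 (m i).
pose F (g : {ffun 'I_n -> option 'I_N.+1}) : vec n :=
  [ffun i => omap (@nat_of_ord _) (g i)].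
apply: (@sub_finite_set _ _ (F @` setT)); last exact/finite_image/finite_finset.
move=> a /= [am infam]; exists [ffun i => omap inord (a i)] => //.
apply/ffunP => i; rewrite !ffunE; case ai: (a i) => [p|] //=.
rewrite inordK // ltnS; apply: (@leq_trans (odflt 0 (m i))); last first.
  exact: (leq_bigmax i).
move/setP/(_ i): infam; rewrite !inE ai.
by move: (am i); rewrite ai; case: (m i).
Qed.

(** The maximal elements form an antichain, so they are finite in number, and each facet lies below
    one of them with the same infinite part. *)
Lemma facets_finite G : multicomplex G -> finite_set (facets G).
Proof.
move=> [_ maxG].
apply: (@sub_finite_set _ _ (\bigcup_(m in maximal_elements G)
   [set a | prec a m /\ infpt a = infpt m])).
  by move=> a [/maxG[m mG am] /(_ m mG am) infa]; exists m.
apply: bigcup_finite => [|m _]; last exact: finite_same_infpt.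
apply: antichain_finite => a b [Ga maxa] [Gb _] ab.
by rewrite (maxa b).
Qed.

Lemma facet_above G x : multicomplex G -> G x -> exists2 a, facets G a & prec x a.
Proof. by move=> [_ maxG] /maxG[m /maximal_facet mG xm]; exists m. Qed.

Lemma down_facets G : multicomplex G -> down (facets G) = G.
Proof.
move=> mG; apply/seteqP; split=> [x [a [Ga _] xa]|x Gx]; first exact: mG.1 xa.
exact: facet_above.
Qed.

(** * Star, deletion and link *)

Section Shedding.
Variables (G : set (vec n)) (d : nvec n).
Hypothesis mG : multicomplex G.

Let facets_sub_finite A : A `<=` facets G -> finite_set A.
Proof. by move=> /sub_finite_set; apply; apply: facets_finite. Qed.

Lemma starE : star G d = down [set b | facets G b /\ prec (fin_vec d) b].
Proof. by apply: generated_finite; apply: facets_sub_finite => b []. Qed.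

Lemma deletionE : deletion G d = down [set b | facets G b /\ ~ prec (fin_vec d) b].
Proof. by apply: generated_finite; apply: facets_sub_finite => b []. Qed.

Lemma linkE : link G d =
  down [set sub_vec b d | b in [set b | facets G b /\ prec (fin_vec d) b]].
Proof.
by apply: generated_finite; apply: finite_image; apply: facets_sub_finite => b [].
Qed.

Lemma deletion_multicomplex : multicomplex (deletion G d).
Proof.
rewrite deletionE; apply: down_finite_multicomplex.
by apply: facets_sub_finite => b [].
Qed.

Lemma link_multicomplex : multicomplex (link G d).
Proof.
rewrite linkE; apply: down_finite_multicomplex; apply: finite_image.
by apply: facets_sub_finite => b [].
Qed.

Lemma fin_vec_prec x : prec (fin_vec d) x ->
  forall i, x i = None \/ exists2 q, x i = Some q & d i <= q.
Proof.
move=> dx i; move: (dx i); rewrite ffunE.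
by case: (x i) => [q|] /= dq; [right; exists q|left].
Qed.

Lemma add_vecK x : sub_vec (add_vec d x) d = x.
Proof.
by apply/ffunP => i; rewrite !ffunE; case: (x i) => //= q; rewrite addKn.
Qed.

Lemma add_vec_inj : injective (add_vec d).
Proof. by move=> x y xy; rewrite -(add_vecK x) xy add_vecK. Qed.

Lemma sub_vecK x : prec (fin_vec d) x -> add_vec d (sub_vec x d) = x.
Proof.
move=> /fin_vec_prec dx; apply/ffunP => i; rewrite !ffunE.
by have [->|[q -> dq]] //= := dx i; rewrite subnKC.
Qed.

Lemma prec_add_vec x y : prec (add_vec d x) (add_vec d y) <-> prec x y.
Proof.
split=> xy i; have := xy i; rewrite !ffunE;
  by case: (x i) (y i) => [p|] [q|] //=; rewrite leq_add2l.
Qed.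

Lemma fin_vec_add x : prec (fin_vec d) (add_vec d x).
Proof. by move=> i; rewrite !ffunE; case: (x i) => //= q; apply: leq_addr. Qed.

Lemma infpt_add_vec x : infpt (add_vec d x) = infpt x.
Proof. by apply/setP => i; rewrite !inE ffunE; case: (x i). Qed.

(** Translation by [d] is an order isomorphism onto the vectors above [d] and preserves infinite
    parts, so being a facet transfers. *)
Lemma facets_link :
  facets (link G d) = [set sub_vec b d | b in [set b | facets G b /\ prec (fin_vec d) b]].
Proof.
have sub_add x b : prec (fin_vec d) b -> prec x (sub_vec b d) <-> prec (add_vec d x) b.
  by move=> db; rewrite -{2}(sub_vecK db) prec_add_vec.
apply/seteqP; split=> [x [/[!linkE] -[_ [b [fb db] <-]] xb maxx]|_ [b [fb db] <-]].
  exists (add_vec d x); last exact: add_vecK.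
  split; last exact: fin_vec_add.
  split=> [|m mG' xm]; first by apply: mG.1 fb.1 _; apply/(sub_add _ _ db).
  have dm : prec (fin_vec d) m by apply: prec_trans xm; apply: fin_vec_add.
  (* It remains to see that [m - d] is maximal in the link, since [x] is a facet there. *)
  rewrite infpt_add_vec -(sub_vecK dm) infpt_add_vec; apply: maxx; last exact/sub_add.
  split.
    apply: sub_down; exists m => //; split=> //; exact: maximal_facet.
  move=> y [_ [c [fc dc] <-] yc] my.
  have mc : prec m c.
    by rewrite -(sub_vecK dm) -(sub_vecK dc) prec_add_vec; apply: prec_trans yc.
  apply: prec_anti => //; apply: prec_trans yc _.
  by rewrite (mG'.2 c fc.1 mc); apply: prec_refl.
split=> [|m /[!linkE] /maximal_down[c [fc dc] <-] bc].
  by rewrite linkE; apply: sub_down; exists b.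
have {}bc : prec b c by rewrite -(sub_vecK db) -(sub_vecK dc) prec_add_vec.
(* The facets [b] and [c] lie below one maximal [m'] of [G] and both share its infinite part. *)
have [m' mm' cm'] := mG.2 c fc.1.
have := fb.2 _ mm' (prec_trans bc cm'); have := fc.2 _ mm' cm'.
rewrite -{1}(sub_vecK db) -{1}(sub_vecK dc) !infpt_add_vec => -> -> //.
Qed.

Lemma facet_star b : facets G b -> prec (fin_vec d) b -> facets (star G d) b.
Proof.
move=> fb db; split=> [|m /[!starE] /maximal_down[fm dm] bm].
  by rewrite starE; apply: sub_down.
have [m' mm' mlem'] := mG.2 m fm.1.
by rewrite (fb.2 m') ?(fm.2 m') //; apply: prec_trans mlem'.
Qed.

(** A facet of the star need not be above [d], but condition (ii) only sees infinite parts, so a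
    facet of [G] above [d] can replace it. *)
Lemma infpt_facet_star b : facets (star G d) b ->
  exists2 m, facets G m /\ prec (fin_vec d) m & infpt b = infpt m.
Proof.
have finS : finite_set [set b | facets G b /\ prec (fin_vec d) b].
  by apply: facets_sub_finite => c [].
rewrite starE => -[/(down_finite_multicomplex finS).2[m mS bm] /(_ m mS bm) infb].
by exists m => //; apply: maximal_down mS.
Qed.

Lemma infpt_facet_deletion c : facets (deletion G d) c ->
  exists2 m, facets G m /\ ~ prec (fin_vec d) m & infpt c = infpt m.
Proof.
move=> [/deletion_multicomplex.2[m mS cm] /(_ m mS cm) infc].
by exists m => //; move: mS; rewrite deletionE => /maximal_down.
Qed.

(** A facet [c] of the deletion could lie below a maximal [m] of [G] that is above [d] and has more
    infinite coordinates; it would then not be a facet of [G]. Condition (ii), applied to [m] and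
    [c], forbids this. *)
Lemma facets_deletion :
  (forall b c, facets (star G d) b -> facets (deletion G d) c ->
     fpt b \subset fpt c -> fpt b = fpt c) ->
  facets (deletion G d) = [set b | facets G b /\ ~ prec (fin_vec d) b].
Proof.
move=> shed; apply/seteqP; split=> [c fc|b [fb db]].
  have := fc.1; rewrite deletionE => -[b [fb db] cb].
  split; last by move=> dc; apply: db; apply: prec_trans cb.
  split=> [|m mm cm]; first exact: mG.1 fb.1 cb.
  have fm := maximal_facet mm.
  have [dm|dm] := pselect (prec (fin_vec d) m).
    by apply/esym/infpt_eq/shed; rewrite ?fptS ?infptS //; apply: facet_star.
  (* Here [m] lies in the deletion and stays maximal there. *)
  apply: fc.2 => //; rewrite deletionE; split; first exact: sub_down.
  by move=> x [y [[Gy _] _] xy] mx; apply: mm.2 => //; apply: mG.1 xy.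
split=> [|m /[!deletionE] /maximal_down[fm dm] bm].
  by rewrite deletionE; apply: sub_down.
have [m' mm' mlem'] := mG.2 m fm.1.
by rewrite (fb.2 m') ?(fm.2 m') //; apply: prec_trans mlem'.
Qed.

End Shedding.

(** * Stanley sets *)

(* The faces between [d] and [a] form a set [d + <m>] with [m] in {0,oo}^n
   exactly when [tight d a]; then [m = cone a]. *)
Definition tight d a : Prop := forall i, a i = Some (d i) \/ a i = None.

Definition cone a : vec n := [ffun i => if a i is None then None else Some 0].

Definition interval d a : set (vec n) := [set x | prec (fin_vec d) x /\ prec x a].

Lemma cone_zero_infinite a : zero_infinite (cone a).
Proof. by move=> i; rewrite ffunE; case: (a i); [left|right]. Qed.

Lemma zero_infinite_cone m : zero_infinite m -> cone m = m.
Proof. by move=> m0; apply/ffunP => i; rewrite ffunE; case: (m0 i) => ->. Qed.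

Lemma cone_add_vec d a : cone (add_vec d a) = cone a.
Proof. by apply/ffunP => i; rewrite !ffunE; case: (a i). Qed.

Lemma tight_cone d a : tight d a <-> add_vec d (cone a) = a.
Proof.
split=> [da|<- i]; last by rewrite !ffunE; case: (a i) => [q|]; [left; rewrite /= addn0|right].
by apply/ffunP => i; rewrite !ffunE; case: (da i) => -> //=; rewrite addn0.
Qed.

Lemma tight_prec d a : tight d a -> prec (fin_vec d) a.
Proof. by move=> da i; rewrite ffunE; case: (da i) => -> /=. Qed.

Lemma generated1 m : generated [set m] = down [set m].
Proof. exact/generated_finite/finite_set1. Qed.

(** Presents a Stanley set as an order interval, so that it can be compared with others through its
    least and greatest elements. *)
Lemma translate_down d m : add_vec d @` down [set m] = interval d (add_vec d m).
Proof.
apply/seteqP; split=> [_ [x [_ -> xm] <-]|x [dx xm]].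
  by split; [apply: fin_vec_add|apply/prec_add_vec].
exists (sub_vec x d); last exact: sub_vecK.
by exists m => //; apply/(prec_add_vec d); rewrite sub_vecK.
Qed.

(* A nonempty set [<a> \ P] with [P] a down-set has largest element [a], so it
   can only be a Stanley set with maximum [a]. *)
Lemma stanley_withP d T a P : (forall x y, prec x y -> P y -> P x) ->
  stanley_with d T (generated [set a] `\` P) <->
  [/\ tight d a, T = down [set cone a] &
      forall x, prec x a -> P x <-> ~ prec (fin_vec d) x].
Proof.
move=> downP; rewrite generated1; split.
  move=> [m [m0 -> ]]; rewrite generated1 translate_down => SE.
  (* The top [d + m] of the interval lies below [a] and outside [P], so [a] is outside [P] too; thus
     [a] is in the interval and equals its top. *)
  have : interval d (add_vec d m) (add_vec d m).
    by split; [apply: fin_vec_add|apply: prec_refl].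
  rewrite -SE => -[[_ -> ma] notP].
  have : interval d (add_vec d m) a.
    rewrite -SE; split; first by exists a => //; apply: prec_refl.
    by move=> Pa; apply: notP; apply: downP Pa.
  move=> [da am]; have aE := prec_anti am ma.
  have cm : cone a = m by rewrite aE cone_add_vec zero_infinite_cone.
  split; [by apply/tight_cone; rewrite cm|by rewrite cm|move=> x xa; split].
    move=> Px dx; have : interval d (add_vec d m) x by split=> //; rewrite -aE.
    by rewrite -SE => -[_]; apply.
  move=> dx; apply: contrapT => Px; apply: dx.
  suff: interval d (add_vec d m) x by case.
  by rewrite -SE; split=> //; exists a.
move=> [/tight_cone aE -> PE]; exists (cone a).
rewrite generated1 translate_down aE; split=> //; first exact: cone_zero_infinite.
apply/seteqP; split=> [x [[_ -> xa] Px]|x [dx xa]].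
  by split=> //; apply: contrapT => dx; apply: Px; apply/(PE _ xa).
by split; [exists a|move=> /(PE _ xa)].
Qed.

(** Turns the inclusion of the sets [S^*] in condition (2) of shellability into one of infinite
    parts. *)
Lemma down_cone a b : (down [set cone a] `<=` down [set cone b]) <-> infpt a \subset infpt b.
Proof.
split=> [ab|/fintype.subsetP ab x [_ -> xa]].
  have [_ -> /infptS] := ab _ (sub_down (erefl (cone a))).
  have E c : infpt (cone c) = infpt c by apply/setP => i; rewrite !inE ffunE; case: (c i).
  by rewrite !E.
exists (cone b) => //; apply: prec_trans xa _ => i; have := ab i; rewrite !inE !ffunE.
by case: (a i) (b i) => [p|] [q|] //= /(_ isT).
Qed.

(** * Shellings as sequences *)

Implicit Types (s t : seq (vec n)).

(** With [P] the faces generated by the earlier facets, this is the Stanley condition on the step of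
    [a], as unfolded by [stanley_withP]. *)
Definition shelling_cond P a : Prop :=
  exists2 d, tight d a & forall x, prec x a -> P x <-> ~ prec (fin_vec d) x.

(** Condition (2) of shellability for [a] listed before [b]; in the reverse order it is automatic,
    so [pairwise] captures all of it. *)
Definition compatible a b : bool :=
  (infpt a \subset infpt b) ==> (infpt a == infpt b).

Definition shelling s : Prop :=
  (forall i, i < size s -> shelling_cond (down [set` take i s]) (nth [ffun=> None] s i))
  /\ pairwise compatible s.

Lemma mem_seqE A s : A = [set` s] -> forall b, b \in s <-> A b.
Proof. by move=> ->. Qed.

Lemma nth_codom_ord T r (x0 : T) (a : 'I_r -> T) (i : 'I_r) : nth x0 (codom a) i = a i.
Proof. by rewrite codomE (nth_map i) ?size_enum_ord // nth_ord_enum. Qed.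

Lemma shelling_stepE r (a : 'I_r -> vec n) (i : 'I_r) :
  shelling_step a i = generated [set a i] `\` down [set` take i (codom a)].
Proof.
rewrite /shelling_step; congr (_ `\` _).
have -> : [set a j | j in [set j : 'I_r | j < i]] = [set` take i (codom a)].
  apply/seteqP; split=> [x [j /= ji <-]|x /= /(nthP (a i))[j]].
    apply/(nthP (a i)); exists j.
      by rewrite size_takel ?size_codom ?card_ord // ltnW.
    by rewrite nth_take // nth_codom_ord.
  rewrite size_takel ?size_codom ?card_ord ?(ltnW (ltn_ord i)) // => ji.
  have jr := ltn_trans ji (ltn_ord i).
  rewrite nth_take // => <-; exists (Ordinal jr) => //.
  by rewrite -(nth_codom_ord (a i)).
exact/generated_finite/finite_seq.
Qed.

(** Sequences support the concatenation and the induction on the last facet on which the two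
    directions rest. *)
Lemma shellableP G :
  shellable G <-> exists s, [/\ uniq s, facets G = [set` s] & shelling s].
Proof.
have downP A : forall x y, prec x y -> down A y -> down A x by exact: downS.
split=> [[r [a [inja fG stan comp]]]|[s [uniq_s fG [step comp]]]].
  have stepE i : exists2 d, tight d (a i) &
      forall x, prec x (a i) -> down [set` take i (codom a)] x <-> ~ prec (fin_vec d) x.
    have [d [T]] := stan i; rewrite shelling_stepE => /(stanley_withP _ _ _ (downP _))[].
    by exists d.
  exists (codom a); split.
  - by rewrite /codom map_inj_uniq ?enum_uniq.
  - rewrite fG; apply/seteqP; split=> [_ [i _ <-]|_ /= /codomP[i ->]]; last by exists i.
    exact: codom_f.
  split=> [i|]; first rewrite size_codom card_ord => ir.
    by rewrite (nth_codom_ord _ _ (Ordinal ir)); apply: (stepE (Ordinal ir)).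
  apply/(pairwiseP [ffun=> None]) => i j; rewrite !inE size_codom card_ord => ir jr ij.
  rewrite (nth_codom_ord _ _ (Ordinal ir)) (nth_codom_ord _ _ (Ordinal jr)); apply/implyP => sub_ij.
  have star k : stanley_star (shelling_step a k) (down [set cone (a k)]).
    have [d td dP] := stepE k; exists d; rewrite shelling_stepE.
    by apply/(stanley_withP _ _ _ (downP _)); split.
  have [E|] := comp _ _ _ _ (star (Ordinal ir)) (star (Ordinal jr)) ((down_cone _ _).2 sub_ij).
    by rewrite finset.eqEsubset sub_ij /=; apply/down_cone; rewrite E.
  by rewrite ltnNge (ltnW ij).
exists (size s), (tnth (in_tuple s)).
have codom_s : codom (tnth (in_tuple s)) = s by rewrite codomE map_tnth_enum.
have tnthE i : tnth (in_tuple s) i = nth [ffun=> None] s i by rewrite (tnth_nth [ffun=> None]).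
split.
- exact/tuple_uniqP.
- rewrite fG; apply/seteqP; split=> [x /= xs|_ [i _ <-]]; last exact: mem_tnth.
  by move: xs; rewrite -{1}codom_s => /codomP[i ->]; exists i.
- move=> i; have [d td dP] := step i (ltn_ord i).
  exists d, (down [set cone (tnth (in_tuple s) i)]); rewrite shelling_stepE codom_s.
  by apply/(stanley_withP _ _ _ (downP _)); rewrite tnthE.
move=> i j Si Sj [di] + [dj]; rewrite !shelling_stepE codom_s.
move=> /(stanley_withP _ _ _ (downP _))[_ -> _] /(stanley_withP _ _ _ (downP _))[_ -> _].
move=> /down_cone sub_ij; have [ij|ji|/val_inj ->] := ltngtP i j; [|by right|by left].
left; move/(pairwiseP [ffun=> None]): comp => /(_ i j (ltn_ord i) (ltn_ord j) ij).
rewrite -!tnthE /compatible sub_ij /= => /eqP E.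
by apply/seteqP; split; apply/down_cone; rewrite E.
Qed.

(** * Decomposable multicomplexes are shellable *)

Lemma k_decomposable_shellable k G : k_decomposable k G -> multicomplex G -> shellable G.
Proof.
elim=> {G} [G b fG|G d [Gd _ shed1 shed2] _ IHl _ IHd] mG.
  apply/shellableP; exists [:: b]; split=> //.
    by rewrite fG; apply/seteqP; split=> x; rewrite /= inE => /eqP.
  split=> // -[|//] _ /=; have fb : facets G b by rewrite fG.
  have topb x : G x -> prec x b.
    by move=> /(facet_above mG)[a]; rewrite fG => ->.
  (* Since [cone b] has the infinite part of [b], it is a facet as well, hence equal to [b]; so <b>
     is a Stanley set of degree 0. *)
  exists [ffun=> 0] => [i|x xb].
    rewrite ffunE; suff <- : cone b = b by rewrite ffunE; case: (b i); [left|right].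
    have cb : prec (cone b) b by move=> j; rewrite ffunE; case: (b j).
    have : facets G (cone b); last by rewrite fG.
    split=> [|m [Gm maxm] _]; first exact: mG.1 fb.1 cb.
    rewrite -(maxm b fb.1 (topb _ Gm)).
    by apply/setP => i'; rewrite !inE ffunE; case: (b i').
  split=> [[y]//|[]]; by move=> j; rewrite !ffunE; case: (x j).
have /shellableP[s1 [uniq1 f1 [step1 comp1]]] := IHd (deletion_multicomplex d mG).
have /shellableP[s2 [uniq2 f2 [step2 comp2]]] := IHl (link_multicomplex d mG).
have mem1 := mem_seqE (etrans (esym (facets_deletion mG shed2)) f1).
have mem_s2 := mem_seqE (etrans (esym (facets_link d mG)) f2).
have mem2 b : b \in [seq add_vec d x | x <- s2] <-> facets G b /\ prec (fin_vec d) b.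
  split=> [/mapP[x /mem_s2[c [fc dc] <-] ->]|[fb db]]; first by rewrite sub_vecK.
  by apply/mapP; exists (sub_vec b d); rewrite ?sub_vecK //; apply/mem_s2; exists b.
have delE : down [set` s1] = deletion G d.
  by rewrite -f1; apply/down_facets/deletion_multicomplex.
apply/shellableP; exists (s1 ++ [seq add_vec d x | x <- s2]); split.
- rewrite cat_uniq uniq1 map_inj_uniq ?uniq2 ?andbT /=; last first.
    exact: add_vec_inj.
  by apply/hasPn => b /mem2[_ db]; apply/negP => /mem1[].
- apply/seteqP; split=> b /=.
    move=> fb; rewrite mem_cat; have [db|db] := pselect (prec (fin_vec d) b).
      by apply/orP; right; apply/mem2.
    by apply/orP; left; apply/mem1.
  by rewrite mem_cat => /orP[/mem1[]|/mem2[]].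
split=> [i|].
  rewrite size_cat size_map nth_cat take_cat; case: (ltnP i (size s1)) => [i1 _|i1 i2].
    exact: step1.
  have {i2} i2 : i - size s1 < size s2 by lia.
  move: (i - size s1) i2 => {i1 i} i i2; rewrite (nth_map [ffun=> None]) // -map_take.
  set e := nth _ s2 i; have [f tf fP] := step2 i i2.
  have [fe de] : facets G (add_vec d e) /\ prec (fin_vec d) (add_vec d e).
    by apply/mem2/map_f/mem_nth.
  (* By (i), a face below [d + e] is in the deletion exactly when it is not above [d]. *)
  have [T /stanley_withP[|td _ delP]] := shed1 _ (facet_star mG fe de) de.
    by move=> x y xy yD; apply: (deletion_multicomplex d mG).1 yD xy.
  (* Degrees add: [f] is the degree of the step of [e] in the link. *)
  exists [ffun j => d j + f j] => [j|x xe].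
    by rewrite !ffunE; case: (tf j) => -> /=; [left|right].
  have addf y : prec (fin_vec [ffun j => d j + f j]) (add_vec d y) <-> prec (fin_vec f) y.
    by split=> + j => /(_ j); rewrite !ffunE; case: (y j) => //= q; rewrite leq_add2l.
  (* A face not above [d] is already covered by the deletion; one above [d] is not, and subtracting
     [d] moves the question to the link. *)
  have [dx|dx] := pselect (prec (fin_vec d) x); last first.
    split=> _; last by have [a as1 xa] : down [set` s1] x
      by [rewrite delE; apply/delP]; exists a; rewrite //= mem_cat as1.
    move=> fx; apply: dx; apply: prec_trans fx => j; rewrite !ffunE /=; exact: leq_addr.
  have ye : prec (sub_vec x d) e by apply/(prec_add_vec d); rewrite sub_vecK.
  rewrite -{2}(sub_vecK dx) addf -fP //; split.
    move=> [a /= + xa]; rewrite mem_cat => /orP[as1|/mapP[c ct aE]].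
      by case: (delP x xe) => /(_ _ dx) []; rewrite -delE; exists a.
    by exists c => //; apply/(prec_add_vec d); rewrite sub_vecK // -aE.
  move=> [c ct xc]; exists (add_vec d c); first by rewrite /= mem_cat map_f ?orbT.
  by rewrite -(sub_vecK dx) prec_add_vec.
rewrite pairwise_cat comp1 pairwise_map; apply/and3P; split=> //.
  (* Facets of the deletion precede those above [d], so compatibility is condition (ii) read on
     complements. *)
  apply/allrelP => c b cs /mem2[fb db]; apply/implyP => sub_cb; apply/eqP/infpt_eq/esym.
  apply: shed2; rewrite ?fptS //; first exact: facet_star.
  by rewrite f1.
by apply: sub_pairwise comp2 => a b; rewrite /= /compatible !infpt_add_vec.
Qed.

(** * Nonempty shellable multicomplexes are decomposable *)

Lemma shellable_k_decomposable G : multicomplex G -> G !=set0 -> shellable G ->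
  exists k, k_decomposable k G.
Proof.
move=> mG G0 /shellableP[s [uniq_s fG [step comp]]]; exists n.
elim/last_ind: s => [|s a IHs] in G mG G0 fG uniq_s step comp *.
  by have [x /(facet_above mG)[b]] := G0; rewrite fG.
have [s0|s0] := eqVneq s [::].
  apply: (@Decomposable_one_facet _ _ _ a); rewrite fG s0.
  by apply/seteqP; split=> x; rewrite /= inE => /eqP.
have [d td dP] : shelling_cond (down [set` s]) a.
  have := step (size s); rewrite size_rcons nth_rcons -cats1 take_size_cat // ltnn eqxx.
  exact.
move: uniq_s; rewrite rcons_uniq => /andP[a_s uniq_s].
have fGE := mem_seqE fG.
have fa : facets G a by apply/fGE; rewrite mem_rcons mem_head.
have da := tight_prec td.
(* An earlier facet above [d] would put [d] among the faces already covered, against [dP]. *)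
have notd b : b \in s -> ~ prec (fin_vec d) b.
  move=> bs db; have [out _] := dP _ da.
  by apply: out; [exists b|apply: prec_refl].
have aboveE : [set b | facets G b /\ prec (fin_vec d) b] = [set a].
  apply/seteqP; split=> [b /= [/fGE]|_ /= ->]; last by [].
  by rewrite mem_rcons inE => /predU1P[//|/notd].
have belowE : [set b | facets G b /\ ~ prec (fin_vec d) b] = [set` s].
  apply/seteqP; split=> b /= => [[/fGE]|bs]; last first.
    by split; [apply/fGE; rewrite mem_rcons inE bs orbT|apply: notd].
  by rewrite mem_rcons inE => /predU1P[->|].
move: comp; rewrite pairwise_rcons => /andP[/allP compa comps].
have shed b c : facets (star G d) b -> facets (deletion G d) c ->
    fpt b \subset fpt c -> fpt b = fpt c.
  (* Up to infinite parts, [b] is [a] and [c] is an earlier facet [c'], which is compatible with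
     [a]. *)
  move=> /(infpt_facet_star mG)[b'].
  rewrite -[_ /\ _]/([set b | facets G b /\ prec (fin_vec d) b] b') aboveE => -> infb.
  move=> /(infpt_facet_deletion mG)[c'].
  rewrite -[_ /\ _]/([set b | facets G b /\ ~ prec (fin_vec d) b] c') belowE.
  move=> /compa /implyP + infc; rewrite fptS infpt_eq infb infc.
  by move=> /[apply] /eqP.
have delE : deletion G d = down [set` s] by rewrite (deletionE _ mG) belowE.
apply: (@Decomposable_shedding _ _ _ d).
- split=> //; first exact: mG.1 fa.1 da.
    by apply: leq_trans (max_card _) _; rewrite card_ord.
  move=> b fb db; suff -> : b = a.
    exists (down [set cone a]); apply/stanley_withP => [x y xy|].
      by rewrite delE; apply: downS.
    by split=> // x xa; rewrite delE; apply: dP.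
  (* The star is <a>, so [b] lies below [a] and has the same infinite part; by tightness the finite
     coordinates of [a] are those of [d], which are at most those of [b]. *)
  have := fb.1; rewrite (starE _ mG) aboveE => -[_ -> ba].
  have [b'] := infpt_facet_star mG fb.
  rewrite -[_ /\ _]/([set b | facets G b /\ prec (fin_vec d) b] b') aboveE => -> infb.
  apply: prec_anti => // i; have [ai|ai] := td i.
    by have := db i; rewrite ffunE ai.
  by move/setP/(_ i): infb; rewrite !inE ai eqxx => /eqP ->.
- apply: (@Decomposable_one_facet _ _ _ (sub_vec a d)).
  by rewrite (facets_link _ mG) aboveE image_set1.
apply: IHs => //.
- exact: deletion_multicomplex.
- case: s s0 {fG fGE notd belowE step dP a_s uniq_s compa comps} delE => // x s _ ->.
  by exists x; apply: sub_down; apply: mem_head.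
- by rewrite (facets_deletion mG shed).
move=> i i_s; have := step i; rewrite size_rcons nth_rcons i_s => /(_ (ltnW i_s)).
by rewrite -cats1 takel_cat // ltnW.
Qed.

End Multicomplex.

Theorem theorem3p8 (n : nat) (G : set (vec n)) (hG : multicomplex G) :
  (forall k : nat, k_decomposable k G -> shellable G) /\
  (G !=set0 -> shellable G -> exists k : nat, k_decomposable k G).
Proof.
split=> [k /k_decomposable_shellable|]; first exact.
exact: shellable_k_decomposable.
Qed.
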